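(* Let $p>3$ be a prime number. Then $$\sum_{\substack{1\le m\le p-1\\ m\text{ odd}}}(-1)^{\frac{m+1}{2}}\,m\,T_m\equiv\begin{cases}0\pmod p&\text{if }p\equiv 1\pmod 4,\\ 2\pmod p&\text{if }p\equiv 3\pmod 4.\end{cases}$$
   Context: $T_m$ denotes the $m$-th tangent number, the integer defined by the series expansion $\tan z=\sum_{m\ge 0}T_m\frac{z^m}{m!}$ for $|z|<\frac{\pi}{2}$ (so $T_1=1$, $T_3=2$, $T_5=16$, $T_7=272$, and $T_m=0$ for $m$ even). *)

(* Defs.v *)
From mathcomp Require Import all_boot all_order all_algebra.
From mathcomp Require Import all_classical all_reals all_analysis.

Set Implicit Arguments.
Unset Strict Implicit.
Unset Printing Implicit Defensive.

Import Order.TTheory GRing.Theory Num.Theory.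
Import numFieldNormedType.Exports.

Local Open Scope classical_set_scope.
Local Open Scope ring_scope.

(** Requiring the expansion for real [z] only already determines [T]. *)
Definition tangent_numbers (R : realType) (T : nat -> int) : Prop :=
  forall z : R, `|z| < pi / 2 ->
    series (fun m : nat => (T m)%:~R * (z ^+ m / m`!%:R)) @ \oo --> tan z.

(* Main.v *)
Require Import Defs.
From mathcomp Require Import all_boot all_order all_algebra.
From mathcomp Require Import all_classical all_reals all_analysis.
From mathcomp Require Import ring lra zify.

(** The integers [t_m = (-1)^(m/2) T_m] are the Taylor coefficients of [tanh], so
    the linear functional [L] on polynomials with [L(x^m) = t_m] satisfies
    [L(q(x+1) + q(x-1)) = q(1) - q(-1)].  (This is [tan * cos = sin] read on
    coefficients, by comparing Taylor polynomials up to O(z^n).)  In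
    characteristic [p], shifting [p] times by 2 is the identity, and the
    alternating sum of this relation over these shifts gives
    [L(q) = q(0) - \sum_(j < p) (-1)^j q(2j)].  The required sum is [- L(g)] with
    [g = \sum_(i < p) i x^i], and on 'F_p the function [g] is [- x / (x - 1)]
    (and 0 at 1); the substitution [j -> p + 1 - j] then evaluates the
    alternating sum to [1 + (-1)^((p+1)/2)]. *)

Import Order.TTheory GRing.Theory Num.Theory.
Import numFieldNormedType.Exports.

Local Open Scope ring_scope.

(** * Binomial expansions and finite sums *)

Lemma exprXaddC (R : comNzRingType) (c : R) n :
  ('X + c%:P) ^+ n = \poly_(i < n.+1) (c ^+ (n - i) *+ 'C(n, i)).
Proof.
rewrite addrC exprDn poly_def; apply: eq_bigr => i _.
by rewrite -polyC_exp mul_polyC scalerMnl.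
Qed.

(** This is the differentiated geometric sum with its denominators cleared, so that induction on [n]
    needs no division. *)
Lemma sqr_sub1_mul_sum_iX (R : comNzRingType) (x : R) n :
  (x - 1) ^+ 2 * (\sum_(i < n) i%:R * x ^+ i)
    = n%:R * x ^+ n * (x - 1) - x * (x ^+ n - 1).
Proof.
elim: n => [|n IHn]; first by rewrite big_ord0; ring.
rewrite big_ord_recr mulrDr IHn /= (exprS x n) mulrSr.
by move: (x ^+ n) => y; ring.
Qed.

(* Since [1^-1] is read as [0^-1 = 0] at [x = 1], the formula has no exception. *)
Lemma sum_iX_pchar (F : fieldType) (p : nat) (x : F) :
  p \in [pchar F] -> (2 < p)%N -> x ^+ p = x ->
  \sum_(i < p) i%:R * x ^+ i = - (x != 1)%:R - (x - 1)^-1.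
Proof.
move=> chp p2 xp; have [->|x1] := eqVneq x 1.
  rewrite subrr invr0 subr0 /= oppr0.
  under eq_bigr do rewrite expr1n mulr1.
  rewrite -natr_sum -(big_mkord xpredT id) bin2_sum.
  by apply/eqP; rewrite -(dvdn_pcharf chp) prime_dvd_bin // (pcharf_prime chp).
have x1' : x - 1 != 0 by rewrite subr_eq0.
apply: (mulfI (expf_neq0 2 x1')).
rewrite sqr_sub1_mul_sum_iX (pcharf0 chp) xp /=.
by field.
Qed.

Lemma alt_sum_sign (R : pzRingType) n : \sum_(j < n) (-1) ^+ j = (odd n)%:R :> R.
Proof.
elim: n => [|n IHn]; first by rewrite big_ord0.
rewrite big_ord_recr /= IHn -signr_odd.
by case: (odd n); rewrite ?subrr ?add0r.
Qed.

(** The alternating sum over [p + 1] terms is split off at its first and at its last term; as [p] is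
    odd, the last one is [- a p = - a 0]. *)
Lemma alt_sum_shift (R : comNzRingType) (p : nat) (a : nat -> R) :
  odd p -> a p = a 0%N ->
  \sum_(j < p) (-1) ^+ j * a j.+1 = a 0%N *+ 2 - \sum_(j < p) (-1) ^+ j * a j.
Proof.
move=> odd_p ap.
have : \sum_(j < p.+1) (-1) ^+ j * a j = \sum_(j < p.+1) (-1) ^+ j * a j by [].
rewrite {1}big_ord_recl big_ord_recr /= -(signr_odd _ p) odd_p ap expr0 expr1.
under eq_bigr => j _ do rewrite exprS mulN1r mulNr.
rewrite sumrN mulN1r mul1r => /(canRL (addKr _)) /(canRL (@opprK _)) ->; ring.
Qed.

(** * The umbral functional and its shift relation *)

(** Truncating at a fixed [N] instead of [size q] makes linearity termwise; nothing is lost when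
    [size q <= N]. *)
Definition umbral {R : nzRingType} (N : nat) (t : nat -> R) (q : {poly R}) : R :=
  \sum_(k < N) q`_k * t k.

Section Umbral.
Variables (R : idomainType) (N : nat) (t : nat -> R).
Local Notation L := (umbral N t).

Lemma umbralD q r : L (q + r) = L q + L r.
Proof. by rewrite -big_split; apply: eq_bigr => k _; rewrite coefD mulrDl. Qed.

Lemma umbralZ c q : L (c *: q) = c * L q.
Proof. by rewrite mulr_sumr; apply: eq_bigr => k _; rewrite coefZ mulrA. Qed.

Lemma umbral_sum I (s : seq I) (P : pred I) (F : I -> {poly R}) :
  L (\sum_(i <- s | P i) F i) = \sum_(i <- s | P i) L (F i).
Proof.
elim/big_rec2: _ => [|i x y _ <-]; last exact: umbralD.
by apply: big1 => k _; rewrite coef0 mul0r.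
Qed.

Hypothesis t_rec : forall n,
  \sum_(k < n.+1) (~~ odd (n - k))%:R * 'C(n, k)%:R * t k = (odd n)%:R.

(** Adding the two binomial expansions doubles the terms with [n - k] even and cancels the others,
    which leaves twice [t_rec], the coefficient form of tanh * cosh = sinh. *)
Lemma umbral_shift1_Xn n : (n < N)%N ->
  L (('X + 1%:P) ^+ n) + L (('X + (-1)%:P) ^+ n) = 1 - (-1) ^+ n.
Proof.
move=> ltnN; rewrite -umbralD !exprXaddC.
transitivity (2 * \sum_(k < n.+1) (~~ odd (n - k))%:R * 'C(n, k)%:R * t k).
  rewrite mulr_sumr (big_ord_widen N
    (fun k => 2 * ((~~ odd (n - k))%:R * 'C(n, k)%:R * t k))) //.
  rewrite big_mkcond; apply: eq_bigr => k _ /=.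
  rewrite coefD !coef_poly; case: ifP => _; last by rewrite addr0 mul0r.
  rewrite expr1n -signr_odd; case: (odd _) => /=.
    by rewrite expr1 mulNrn subrr !mul0r mulr0.
  by rewrite expr0; ring.
by rewrite t_rec -signr_odd; case: (odd n); rewrite /= ?expr0 ?expr1; ring.
Qed.

Lemma umbral_shift1 (q : {poly R}) : (size q <= N)%N ->
  L (q \Po ('X + 1%:P)) + L (q \Po ('X + (-1)%:P)) = q.[1] - q.[-1].
Proof.
move=> szq; rewrite !comp_polyE !umbral_sum !horner_coef -big_split -sumrB /=.
apply: eq_bigr => i _; rewrite !umbralZ -mulrDr umbral_shift1_Xn.
  by rewrite expr1n mulrBr.
exact: leq_trans (ltn_ord i) szq.
Qed.

Lemma umbral_shift2 (q : {poly R}) c : (size q <= N)%N ->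
  L (q \Po ('X + (c + 2)%:P)) + L (q \Po ('X + c%:P)) = q.[c + 2] - q.[c].
Proof.
(* The unit shift relation is applied to [q] translated by [c + 1], the midpoint of [c] and
   [c + 2]. *)
move=> szq; have sz_r : (size (q \Po ('X + (c + 1)%:P)%R) <= N)%N.
  by rewrite size_comp_poly2 ?size_XaddC.
have := umbral_shift1 _ sz_r; rewrite -!comp_polyA !horner_comp.
rewrite !comp_polyD !comp_polyX !comp_polyC -!addrA -!polyCD !(hornerD, hornerX, hornerC).
by rewrite (_ : 1 + (c + 1) = c + 2) 1?(_ : -1 + (c + 1) = c) //; ring.
Qed.

End Umbral.

(** * Evaluation in characteristic p *)

Section UmbralChar.
Variables (F : fieldType) (p : nat) (chp : p \in [pchar F]) (p2 : (2 < p)%N).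

Let hp : prime p := pcharf_prime chp.

Let odd_p : odd p.
Proof. by case: (even_prime hp) p2 => // ->. Qed.

Let two_neq0 : 2%:R != 0 :> F.
Proof. by rewrite -(dvdn_pcharf chp) gtnNdvd. Qed.

Lemma alt_sum_inv_pchar :
  \sum_(j < p) (-1) ^+ j * ((2 * j)%:R - 1)^-1 = - 2%:R :> F.
Proof.
pose f j : F := (-1) ^+ j * ((2 * j)%:R - 1)^-1.
rewrite -(big_mkord xpredT f) big_ltn ?prime_gt0 // big_ltn ?prime_gt1 //.
suff -> : \sum_(2 <= j < p) f j = 0.
  rewrite /f muln0 muln1 sub0r invrN invr1 expr0 expr1.
  by rewrite (_ : 2%:R - 1 = 1 :> F); [rewrite invr1; ring | ring].
(* Under [j -> p + 1 - j] the sign is kept, [p + 1] being even, and [2j - 1] changes sign. The fixed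
   point [j = (p + 1) / 2] contributes [0^-1 = 0]. *)
suff E : \sum_(2 <= j < p) f j = - \sum_(2 <= j < p) f j.
  apply: (mulfI two_neq0); rewrite mulr0 mulr_natl mulr2n.
  by rewrite {1}E addNr.
rewrite {1}big_nat_rev -sumrN /= !big_nat; apply: eq_bigr => j /andP[j2 jp].
rewrite /f -mulrN -invrN.
have -> : (2 + p - j.+1 = p.+1 - j)%N by rewrite add2n subSS.
have jp' : (j <= p.+1)%N by rewrite ltnW // ltnW.
rewrite -signr_odd oddB //= odd_p /= signr_odd; congr (_ * _^-1).
rewrite natrM natrB // -(addn1 p) natrD (pcharf0 chp) natrM; ring.
Qed.

Lemma natr_eq1_pchar j : (j < p)%N -> ((2 * j)%:R == 1 :> F) = (j == p.+1./2).
Proof.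
move=> jp; apply/eqP/eqP => [j1|->].
  (* Adding [p - 1] replaces [2j - 1] without natural subtraction; size and parity leave only the
     quotient 2. *)
  have : (p %| 2 * j + p.-1)%N.
    rewrite (dvdn_pcharf chp) natrD j1 -[1]/(1%:R) -natrD add1n prednK ?prime_gt0 //.
    by rewrite (pcharf0 chp).
  case/dvdnP=> -[|[|[|k]]]; first [lia | nia].
by rewrite mul2n even_halfK /= ?odd_p // -(addn1 p) natrD (pcharf0 chp) add0r.
Qed.

Variables (N : nat) (t : nat -> F).
Hypothesis t_rec : forall n,
  \sum_(k < n.+1) (~~ odd (n - k))%:R * 'C(n, k)%:R * t k = (odd n)%:R.

Lemma umbral_pchar (q : {poly F}) : (size q <= N)%N ->
  umbral N t q = q.[0] - \sum_(j < p) (-1) ^+ j * q.[(2 * j)%:R].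
Proof.
move=> szq.
pose a j := umbral N t (q \Po ('X + ((2 * j)%:R)%:P)).
pose b j := q.[(2 * j)%:R].
have H j : a j.+1 + a j = b j.+1 - b j.
  have := @umbral_shift2 _ _ _ t_rec q (2 * j)%:R szq.
  by rewrite (_ : (2 * j)%:R + 2 = (2 * j.+1)%:R) // mulnS addnC natrD.
have p0 : (2 * p)%:R = (2 * 0)%:R :> F by rewrite natrM (pcharf0 chp) mulr0 muln0.
have Ha : a p = a 0%N by rewrite /a p0.
have Hb : b p = b 0%N by rewrite /b p0.
have: \sum_(j < p) (-1) ^+ j * (a j.+1 + a j) = \sum_(j < p) (-1) ^+ j * (b j.+1 - b j).
  by apply: eq_bigr => j _; rewrite H.
under eq_bigr do rewrite mulrDr.
under [in RHS]eq_bigr do rewrite mulrBr.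
(* The left side collapses to [2 * a 0], the right one to twice the claimed value. *)
rewrite big_split sumrB /= !alt_sum_shift // subrK.
rewrite -mulr_natl /a /b muln0 addr0 comp_polyXr => E.
by apply: (mulfI two_neq0); rewrite E; ring.
Qed.

Lemma umbral_sum_iX : (p <= N)%N ->
  - umbral N t (\poly_(i < p) i%:R) = 1 + (-1) ^+ p.+1./2.
Proof.
move=> pN.
have gE (x : F) : x ^+ p = x ->
    (\poly_(i < p) i%:R).[x] = - (x != 1)%:R - (x - 1)^-1.
  by move=> xp; rewrite horner_poly sum_iX_pchar.
rewrite umbral_pchar; last exact: leq_trans (size_poly _ _) pN.
rewrite gE ?expr0n ?gtn_eqF ?prime_gt0 //.
rewrite eq_sym oner_eq0 sub0r invrN invr1 opprK addNr sub0r opprK.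
have h2 : (p.+1./2 < p)%N.
  by rewrite -divn2 ltn_divLR // muln2 -addnn -addn1 ltn_add2l prime_gt1.
(* [gE] applies at [2j] because Frobenius fixes the images of naturals; the point 1 is reached
   exactly at [j = (p + 1) / 2]. *)
transitivity (\sum_(j < p) - ((-1) ^+ j * (j != p.+1./2 :> nat)%:R
                              + (-1) ^+ j * ((2 * j)%:R - 1)^-1) : F).
  apply: eq_bigr => j _; rewrite gE; first by rewrite natr_eq1_pchar //; ring.
  by rewrite -!(pFrobenius_autE chp) pFrobenius_aut_nat.
rewrite sumrN big_split alt_sum_inv_pchar /=.
have -> : \sum_(j < p) (-1) ^+ j * (j != p.+1./2 :> nat)%:R
     = \sum_(j < p) (-1) ^+ j - (-1) ^+ p.+1./2 :> F.
  rewrite (bigD1 (Ordinal h2)) //= eqxx mulr0 add0r.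
  rewrite [in RHS](bigD1 (Ordinal h2)) //= addrAC subrr add0r.
  by apply: eq_bigr => j; rewrite -val_eqE /= => ->; rewrite mulr1.
by rewrite alt_sum_sign odd_p /=; ring.
Qed.

End UmbralChar.

(** * Comparison of Taylor polynomials *)

(** Equality up to O(z^n) as z tends to 0 from the right; one side already determines the
    coefficients below [n] and keeps the powers of [z] positive. *)
Definition eqO {R : realType} (n : nat) (f g : R -> R) : Prop :=
  exists d K, [/\ 0 < d, 0 <= K & forall z, 0 < z < d -> `|f z - g z| <= K * z ^+ n].

Lemma horner_bound {R : realType} (P : {poly R}) :
  exists2 B, 0 <= B & forall z, 0 < z < 1 -> `|P.[z]| <= B.
Proof.
exists (\sum_(i < size P) `|P`_i|); first by rewrite sumr_ge0.
move=> z /andP[z0 z1]; rewrite horner_coef (le_trans (ler_norm_sum _ _ _)) //.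
apply: ler_sum => i _; rewrite normrM ler_piMr // normrX.
by rewrite exprn_ile1 // ger0_norm // ltW.
Qed.

Lemma small_eq0 {R : realType} (x B d : R) : 0 < d ->
  (forall z, 0 < z < d -> `|x| <= B * z) -> x = 0.
Proof.
move=> d0 H; apply/eqP; rewrite -normr_le0; apply/ler_addgt0Pr => e e0.
rewrite add0r; have [B0|B0] := leP B 0.
  have hd : 0 < d / 2 < d by lra.
  rewrite (le_trans (H _ hd)) // (le_trans _ (ltW e0)) // mulr_le0_ge0 //.
  by case/andP: hd => /ltW.
have m0 : 0 < Num.min (d / 2) (e / B) by rewrite lt_min !divr_gt0.
have md : Num.min (d / 2) (e / B) < d by rewrite gt_min; apply/orP; left; lra.
apply: le_trans (H (Num.min (d / 2) (e / B)) _) _; first by rewrite m0.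
by rewrite -ler_pdivlMl // [leRHS]mulrC ge_min lexx orbT.
Qed.

(** Write [P = Q * 'X + c]: small [z] forces [c = 0], and dividing by [z] passes to [Q] with
    exponent one lower. *)
Lemma eqO_poly0 {R : realType} n (P : {poly R}) k :
  eqO n (horner P) (fun=> 0) -> (k < n)%N -> P`_k = 0.
Proof.
elim: n P k => // n IHn P k; elim/poly_ind: P => [|Q c _]; first by rewrite coef0.
move=> [d [K [d0 K0 H]]].
have [B B0 HB] := horner_bound Q.
have dm : 0 < Num.min d 1 by rewrite lt_min d0 ltr01.
have c0 : c = 0.
  apply: (@small_eq0 _ _ (K + B) _ dm) => z /andP[z0]; rewrite lt_min => /andP[zd z1].
  have := H z; rewrite z0 zd => /(_ isT); rewrite subr0 hornerMXaddC => Hz.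
  have -> : c = (Q.[z] * z + c) - Q.[z] * z by rewrite addrAC subrr add0r.
  rewrite (le_trans (ler_normB _ _)) // mulrDl lerD //.
    rewrite (le_trans Hz) // exprS ler_wpM2l // ler_piMr ?(ltW z0) //.
    by rewrite exprn_ile1 // ltW.
  by rewrite normrM (gtr0_norm z0) ler_wpM2r ?(ltW z0) // HB // z0.
rewrite coefD coefMX coefC c0; case: k => [|k] /=; first by rewrite addr0.
rewrite addr0 ltnS; apply: IHn; exists d, K; split => // z /andP[z0 zd].
have := H z; rewrite z0 zd => /(_ isT); rewrite !subr0 hornerMXaddC c0 addr0.
by rewrite normrM (gtr0_norm z0) exprSr mulrA ler_pM2r.
Qed.

Lemma eqOM {R : realType} n (f g : R -> R) (P Q : {poly R}) :
  eqO n f (horner P) -> eqO n g (horner Q) ->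
  eqO n (fun z => f z * g z) (horner (P * Q)).
Proof.
move=> [d1 [K1 [d10 K10 H1]]] [d2 [K2 [d20 K20 H2]]].
have [B1 B10 HB1] := horner_bound P; have [B2 B20 HB2] := horner_bound Q.
exists (Num.min 1 (Num.min d1 d2)), (K1 * (K2 + B2) + B1 * K2); split.
- by rewrite !lt_min ltr01 d10.
- by rewrite addr_ge0 ?mulr_ge0 ?addr_ge0.
move=> z /andP[z0]; rewrite !lt_min => /and3P[z1 zd1 zd2].
have {}H1 := H1 z; rewrite z0 zd1 in H1; have {}H1 := H1 isT.
have {}H2 := H2 z; rewrite z0 zd2 in H2; have {}H2 := H2 isT.
have {}HB1 := HB1 z; rewrite z0 z1 in HB1; have {}HB1 := HB1 isT.
have {}HB2 := HB2 z; rewrite z0 z1 in HB2; have {}HB2 := HB2 isT.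
have zn0 : 0 <= z ^+ n by rewrite exprn_ge0 // ltW.
have zn1 : z ^+ n <= 1 by rewrite exprn_ile1 // ltW.
have Hg : `|g z| <= K2 + B2.
  have -> : g z = (g z - Q.[z]) + Q.[z] by rewrite subrK.
  by rewrite (le_trans (ler_normD _ _)) // lerD // (le_trans H2) // ler_piMr.
have -> : f z * g z - (P * Q).[z] = (f z - P.[z]) * g z + P.[z] * (g z - Q.[z]).
  by rewrite hornerM; ring.
rewrite (le_trans (ler_normD _ _)) // !normrM.
have -> : (K1 * (K2 + B2) + B1 * K2) * z ^+ n
    = K1 * z ^+ n * (K2 + B2) + B1 * (K2 * z ^+ n) by ring.
by rewrite lerD ?ler_pM.
Qed.

Lemma eqO_unique {R : realType} n (f g : R -> R) (P Q : {poly R}) r k : 0 < r ->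
  (forall z, 0 < z < r -> f z = g z) ->
  eqO n f (horner P) -> eqO n g (horner Q) -> (k < n)%N -> P`_k = Q`_k.
Proof.
move=> r0 fg [d1 [K1 [d10 K10 H1]]] [d2 [K2 [d20 K20 H2]]] kn.
apply/eqP; rewrite -subr_eq0 -coefB; apply/eqP/(@eqO_poly0 _ n) => //.
exists (Num.min r (Num.min d1 d2)), (K2 + K1); split.
- by rewrite !lt_min r0 d10.
- exact: addr_ge0.
move=> z /andP[z0]; rewrite !lt_min => /and3P[zr zd1 zd2].
rewrite subr0 hornerD hornerN.
have -> : P.[z] - Q.[z] = (g z - Q.[z]) - (f z - P.[z]).
  by rewrite fg ?z0 //; ring.
by rewrite (le_trans (ler_normB _ _)) // mulrDl lerD ?H1 ?H2 // z0.
Qed.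

(** The extra term [2 * q ^+ (n + j)] makes the bound inductive, since [1 + 2q <= 2]. *)
Lemma geometric_tail {R : realType} (q : R) n j : 0 <= q <= 1 / 2 ->
  \sum_(n <= m < n + j) q ^+ m + 2 * q ^+ (n + j) <= 2 * q ^+ n.
Proof.
move=> /andP[q0 q1]; elim: j => [|j IHj]; first by rewrite addn0 big_geq // add0r.
rewrite addnS big_nat_recr ?leq_addr //= (le_trans _ IHj) //.
rewrite -addrA lerD2l exprS.
have : 0 <= q ^+ (n + j) by rewrite exprn_ge0.
nra.
Qed.

(** Convergence at [r / 2] bounds the terms there by [M]; at [z] below half that point the tail is
    dominated by a geometric series of ratio at most 1/2. *)
Lemma series_eqO {R : realType} n (a : nat -> R) (f : R -> R) (r : R) : 0 < r ->
  (forall z, 0 < z < r -> (series (fun m => a m * z ^+ m) @ \oo --> f z)%classic) ->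
  eqO n f (horner (\poly_(i < n) a i)).
Proof.
move=> r0 H; pose z0 := r / 2.
have z00 : 0 < z0 by rewrite divr_gt0.
have z0r : z0 < r by rewrite /z0; lra.
have [M M0 HM] : exists2 M, 0 <= M & forall m, `|a m| * z0 ^+ m <= M.
  have := H z0; rewrite z00 z0r => /(_ isT) /cvgP /cvg_series_bounded.
  move=> /pinfty_ex_gt0[M M0 HM]; exists M; first exact: ltW.
  by move=> m; have := HM m I; rewrite /= normrM normrX (gtr0_norm z00).
exists (z0 / 2), (2 * M / z0 ^+ n); split.
- by rewrite divr_gt0.
- by rewrite divr_ge0 ?exprn_ge0 ?mulr_ge0 // ltW.
move=> z /andP[zp zz0].
have q01 : 0 <= z / z0 <= 1 / 2.
  by rewrite divr_ge0 ?(ltW zp) ?(ltW z00) //= ler_pdivrMr //; lra.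
have /H cvz : 0 < z < r by rewrite zp; lra.
have -> : 2 * M / z0 ^+ n * z ^+ n = M * (2 * (z / z0) ^+ n).
  by rewrite (expr_div_n z z0); ring.
have HS k : (n <= k)%N ->
   `|series (fun m => a m * z ^+ m) k - (\poly_(i < n) a i).[z]| <= M * (2 * (z / z0) ^+ n).
  move=> nk; rewrite horner_poly -(big_mkord xpredT (fun i => a i * z ^+ i)).
  rewrite /series /= (big_cat_nat (leq0n n) nk) //= addrAC subrr add0r.
  rewrite (le_trans (ler_norm_sum _ _ _)) //.
  apply: (@le_trans _ _ (M * \sum_(n <= m < k) (z / z0) ^+ m)).
    rewrite mulr_sumr; apply: ler_sum => m _.
    rewrite normrM normrX (gtr0_norm zp) expr_div_n mulrCA.
    by rewrite mulrC ler_pM2l ?exprn_gt0 // ler_pdivlMr ?exprn_gt0.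
  rewrite ler_wpM2l // -(subnKC nk).
  apply: le_trans (geometric_tail _ n (k - n) q01).
  rewrite lerDl mulr_ge0 // exprn_ge0 //; by case/andP: q01.
apply: (cvgr_to_le (cvg_norm (cvgB cvz (cvg_cst (\poly_(i < n) a i).[z])))).
near=> k; apply: HS; near: k.
exact: nbhs_infty_ge.
Unshelve. all: by end_near.
Qed.

(** * Tangent numbers and their recurrence *)

Lemma cvg_series_sin {R : realType} (z : R) :
  (series (fun m => (odd m)%:R * (-1) ^+ m.-1./2 / m`!%:R * z ^+ m) @ \oo --> sin z)%classic.
Proof. by rewrite -sin_coeffE unlock; apply: is_cvg_series_sin_coeff. Qed.

Lemma cvg_series_cos {R : realType} (z : R) :
  (series (fun m => (~~ odd m)%:R * (-1) ^+ m./2 / m`!%:R * z ^+ m) @ \oo --> cos z)%classic.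
Proof. by rewrite -cos_coeffE unlock; apply: is_cvg_series_cos_coeff. Qed.

(** From tanh z = -i tan(iz), the sign for odd [m] is i^(m-1). *)
Definition tanh_number (T : nat -> int) (m : nat) : int := (-1) ^+ m./2 * T m.

Lemma tanh_number_rec (R : realType) (T : nat -> int) n : tangent_numbers R T ->
  \sum_(k < n.+1) (~~ odd (n - k))%:R * 'C(n, k)%:R * tanh_number T k = (odd n)%:R.
Proof.
move=> hT.
have pi20 : 0 < pi / 2 :> R by rewrite divr_gt0 ?pi_gt0.
have tanO : @eqO R n.+1 (@tan R) (horner (\poly_(i < n.+1) ((T i)%:~R / i`!%:R))).
  apply: (@series_eqO _ _ _ _ (pi / 2)) => // z /andP[z0 zpi].
  have := hT z; rewrite gtr0_norm // zpi => /(_ isT).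
  rewrite (_ : (fun m => (T m)%:~R * (z ^+ m / m`!%:R))
    = (fun m => (T m)%:~R / m`!%:R * z ^+ m)) //.
  by apply/funext => m; rewrite mulrA mulrAC.
have cosO := @series_eqO R n.+1 _ (@cos R) 1 ltr01 (fun z _ => @cvg_series_cos _ z).
have sinO := @series_eqO R n.+1 _ (@sin R) 1 ltr01 (fun z _ => @cvg_series_sin _ z).
have tancos z : 0 < z < pi / 2 -> tan z * cos z = sin z :> R.
  move=> /andP[z0 zpi]; rewrite /tan divfK // gt_eqF // cos_gt0_pihalf // zpi andbT.
  by rewrite (lt_trans _ z0) // oppr_lt0.
have := eqO_unique _ _ _ _ _ _ n pi20 tancos (eqOM _ _ _ _ _ tanO cosO) sinO (ltnSn n).
rewrite coefM coef_poly ltnSn => E; apply: (@intr_inj R).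
have f0 m : m`!%:R != 0 :> R by rewrite pnatr_eq0 -lt0n fact_gt0.
rewrite rmorph_sum /=.
(* The coefficient of z^n in tan * cos = sin is multiplied by [n!] and by the sign that turns it
   into the hyperbolic identity. *)
transitivity ((-1) ^+ n./2 * n`!%:R * ((odd n)%:R * (-1) ^+ n.-1./2 / n`!%:R) : R).
  rewrite -E mulr_sumr; apply: eq_bigr => k _.
  have kn : (k <= n)%N by rewrite -ltnS.
  rewrite !coef_poly ltn_ord ltnS leq_subr /tanh_number.
  rewrite !rmorphM /= !rmorphXn /= rmorphN1 !rmorph_nat -(bin_fact kn) !natrM.
  have [nk|nk] := boolP (odd (n - k)); first by rewrite /= !mul0r !mulr0.
  (* As [n - k] is even the halves add up, and the sign from the cosine is squared away. *)
  have -> : (n./2 = k./2 + (n - k)./2)%N.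
    by rewrite -{1}(subnKC kn) halfD (negbTE nk) andbF add0n.
  have := f0 k; have := f0 (n - k)%N; rewrite exprD.
  have : (-1) ^+ (n - k)./2 * (-1) ^+ (n - k)./2 = 1 :> R by rewrite -expr2 sqrr_sign.
  move: ((-1) ^+ _ : R) => u uu h1 h2; rewrite mul1r.
  transitivity (u * u * 'C(n, k)%:R * ((-1) ^+ k./2 * (T k)%:~R) : R).
    by rewrite uu mul1r.
  by move: ((-1) ^+ k./2 : R) => /= v; field; rewrite h1 h2.
rewrite rmorph_nat.
case: (boolP (odd n)) => on; last by rewrite /= !mul0r mulr0.
have -> : (n.-1./2 = n./2)%N.
  by rewrite -{1}(odd_double_half n) on /= add0n doubleK.
have uu : (-1) ^+ n./2 * (-1) ^+ n./2 = 1 :> R by rewrite -expr2 sqrr_sign.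
by rewrite mul1r -mulrA [n`!%:R * _]mulrC divfK ?f0 // uu.
Qed.

(** For even [n] the recurrence has right side 0 and involves only even indices, so strong induction
    isolates the last term. *)
Lemma tanh_number_even (R : realType) (T : nat -> int) n : tangent_numbers R T ->
  ~~ odd n -> tanh_number T n = 0.
Proof.
move=> hT; elim/ltn_ind: n => n IHn on; have := tanh_number_rec R T n hT.
rewrite big_ord_recr /= subnn binn !mul1r (negbTE on) big1 ?add0r // => k _.
case: (boolP (odd (n - k))) => [|nk]; first by rewrite /= !mul0r.
rewrite IHn ?mulr0 // -(subKn (ltnW (ltn_ord k))) oddB ?leq_subr //.
by rewrite (negbTE on) (negbTE nk).
Qed.

Theorem theorem3 (R : realType) (T : nat -> int) (hT : tangent_numbers R T)
    (p : nat) (hp : prime p) (hp3 : (3 < p)%N) :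
  ((p = 1 %[mod 4])%N ->
     (\sum_(1 <= m < p | odd m) (-1) ^+ (m.+1 %/ 2) * m%:Z * T m
        = 0 %[mod p%:Z])%Z) /\
  ((p = 3 %[mod 4])%N ->
     (\sum_(1 <= m < p | odd m) (-1) ^+ (m.+1 %/ 2) * m%:Z * T m
        = 2 %[mod p%:Z])%Z).
Proof.
pose S := (\sum_(1 <= m < p | odd m) (-1) ^+ (m.+1 %/ 2) * m%:Z * T m)%R.
rewrite -/S.
have chp : p \in [pchar 'F_p] := pchar_Fp hp.
have S_Fp : S%:~R = 1 + (-1) ^+ p.+1./2 :> 'F_p.
  pose t m : 'F_p := (tanh_number T m)%:~R.
  have t_rec n : \sum_(k < n.+1) (~~ odd (n - k))%:R * 'C(n, k)%:R * t k = (odd n)%:R.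
    have /(congr1 (fun x : int => x%:~R : 'F_p)) := tanh_number_rec R T n hT.
    rewrite rmorph_nat rmorph_sum /= => <-; apply: eq_bigr => k _.
    by rewrite /t !rmorphM /= !rmorph_nat.
  rewrite -(umbral_sum_iX _ _ chp (ltnW hp3) p t t_rec (leqnn p)).
  rewrite /umbral -(big_mkord xpredT (fun k => (\poly_(i < p) i%:R)`_k * t k)).
  rewrite big_ltn ?prime_gt0 // coef_poly prime_gt0 // mul0r add0r.
  rewrite -sumrN /S big_mkcond rmorph_sum /= !big_nat; apply: eq_bigr => m /andP[m0 mp].
  rewrite coef_poly mp /t; case: ifP => om; last first.
    by rewrite (tanh_number_even R) ?om // mulr0 oppr0.
  (* This extra 1 in the exponent gives the minus sign in front of the functional. *)
  have -> : (m.+1 %/ 2 = (m./2).+1)%N by move: om; clear; lia.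
  by rewrite /tanh_number !rmorphM /= exprS mulN1r rmorphN /= -pmulrn !mulNr -mulrA mulrCA.
(* Hence [(p + 1) / 2] has the parity of [(r + 1) / 2]: odd for [r = 1], even for [r = 3]. *)
have p_mod4 r : (p %% 4 = r)%N -> p.+1./2 = ((p %/ 4) * 2 + r.+1./2)%N.
  by move=> <-; lia.
have S_mod c : S%:~R = c%:~R :> 'F_p -> (S = c %[mod p%:Z])%Z.
  move=> E; apply/eqP; rewrite eqz_mod_dvd (dvdz_pcharf chp) rmorphB /= E subrr.
  by rewrite eqxx.
split=> /p_mod4 hm; apply: S_mod; rewrite S_Fp hm -signr_odd oddD oddM andbF /=.
  by rewrite expr1 subrr.
by rewrite expr0.
Qed.
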